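(* Let $n \geq q \geq 1$ be integers and let $$I_{n,q}=\int_{0}^\infty\frac{(\sin x)^n}{x^q}\, dx.$$ The following formulae hold: (i) If $n+q$ is even, then $$I_{n,q}=\frac{(-1)^{\frac{q-n}{2}}\,\pi}{2^{n}(q-1)!}\sum_{k=0}^{\lfloor\frac{n-1}{2}\rfloor}(-1)^k\binom{n}{k}(n-2k)^{q-1}.$$ (ii) If $n+q$ is odd and $q\geq 2$, then $$I_{n,q}=\frac{(-1)^{\frac{q-n+1}{2}}}{2^{n-1}(q-1)!}\sum_{k=0}^{\lfloor\frac{n-1}{2}\rfloor}(-1)^k\binom{n}{k}(n-2k)^{q-1}\log(n-2k).$$
   Context: $\lfloor\cdot\rfloor$ denotes the integer part and $\log$ the natural logarithm. The integral over $(0,\infty)$ is understood as an improper Riemann integral, i.e. $\lim_{\varepsilon\to 0^+}\lim_{R\to\infty}\int_\varepsilon^R \frac{(\sin x)^n}{x^q}\,dx$ (for $q=1$ and $n$ odd it converges only conditionally). *)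

(* Defs.v *)
From Stdlib Require Import Reals ZArith Arith.
From Coquelicot Require Import Coquelicot.

Open Scope R_scope.

(* [is_RInt_gen] takes the limit of the proper Riemann integrals over
   [eps, R] jointly as eps -> 0+ and R -> +oo, without absolute
   convergence.  The integrand being continuous on (0, +oo), this is the same
   as the iterated limit lim_{eps -> 0+} lim_{R -> +oo}.  The value of the
   integrand at 0 plays no role. *)
Definition is_sin_pow_integral (n q : nat) (l : R) : Prop :=
  is_RInt_gen (fun x : R => sin x ^ n / x ^ q)
    (at_right 0) (Rbar_locally p_infty) l.

(* Main.v *)
Require Import Defs.
From Stdlib Require Import Reals ZArith Arith Lra Lia.
From Coquelicot Require Import Coquelicot.

Open Scope R_scope.

(** Write [p = q - 1].  Expanding [sin^n] as a sum of exponentials and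
    differentiating term by term shows that its [j]-th derivative is
    [2^-n] times the sum over [k <= n] of
    [(-1)^k C(n,k) (n-2k)^j cos ((n-2k) x - (n-j) pi/2)]; this is [dsin_pow n j].
    That derivative is bounded and vanishes to order [n - j] at [0]
    ([dsin_pow_bound]), so since [q <= n] one can integrate by parts [p] times,
    with no boundary terms, and the integral becomes [1/p!] times the integral
    of [dsin_pow n p x / x] ([is_RInt_0_infty_dsin_pow_descent]).

    If [n + q] is even, the phase [(n-p) pi/2] is an odd multiple of [pi/2]:
    the cosines are sines up to a common sign, and each term is a Dirichlet
    integral [sin (a x) / x], worth [sign a * pi/2]
    ([is_RInt_0_infty_sin_div]).  If [n + q] is odd, the phase is a multiple of
    [pi] and the terms are [cos (a x) / x], which diverge one by one at [0].  But
    the coefficients add up to [dsin_pow n p 0 = 0], so that [cos (a x)] can be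
    replaced by [cos (a x) - cos x], whose Frullani integral is [- ln |a|]
    ([is_RInt_0_infty_frullani_cos]); the frequency [a = 0] has coefficient [0]
    because [p >= 1].  In both cases the terms [k] and [n - k] agree, which folds
    the sum over [k <= n] onto the positive frequencies ([sum_fold_symmetric]).

    The Dirichlet integral is obtained, by one more integration by parts, from
    that of [(sin x / x)^2].  For the latter, the Fejer kernel
    [(sin (N x) / sin x)^2] has integral exactly [N pi/2] over [[0, pi/2]], and
    it differs from [(sin (N x) / x)^2] by at most [3] there; rescaling by [N]
    shows that the integral up to [N pi/2] is [pi/2 + O(1/N)], and a nonnegative
    integrand makes this sequence decide the improper integral
    ([is_RInt_0_infty_sinc_sqr]). *)

(** * Improper integrals over the half-line *)

Local Notation is_RInt_0_infty f l :=
  (is_RInt_gen f (at_right 0) (Rbar_locally p_infty) l).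

Lemma ex_derive_continuous_R (f : R -> R) (x : R) :
  ex_derive f x -> continuous f x.
Proof. exact (ex_derive_continuous (K := R_AbsRing) (V := R_NormedModule) f x). Qed.

Lemma at_right_0_pos : at_right 0 (fun x => 0 < x).
Proof. exists (mkposreal 1 Rlt_0_1); intros y _ hy; exact hy. Qed.

(** Only bounds [a, b > 0] matter near the two ends, so a property that holds on
    the open half-line holds on all the relevant intervals; [Rmin] and [Rmax]
    are there because [a <= b] is not assumed. *)
Lemma filter_prod_pos (P : R -> Prop) :
  (forall x, 0 < x -> P x) ->
  filter_prod (at_right 0) (Rbar_locally p_infty)
    (fun ab => forall x,
       Rmin (fst ab) (snd ab) <= x <= Rmax (fst ab) (snd ab) -> P x).
Proof.
  intros hP.
  apply Filter_prod with (Q := fun x => 0 < x) (R := fun x => 0 < x).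
  - exact at_right_0_pos.
  - exists 0; intros x hx; exact hx.
  - intros x y hx hy z hz; apply hP; simpl in hz.
    apply Rlt_le_trans with (2 := proj1 hz); now apply Rmin_glb_lt.
Qed.

Lemma is_RInt_0_infty_ext (f g : R -> R) (l : R) :
  (forall x, 0 < x -> f x = g x) -> is_RInt_0_infty f l -> is_RInt_0_infty g l.
Proof.
  intros h; apply is_RInt_gen_ext.
  generalize (filter_prod_pos (fun x => f x = g x) h); apply filter_imp.
  intros ab H x hx; apply H; lra.
Qed.

Lemma is_RInt_0_infty_intro (f : R -> R) (l : R) :
  (forall eps, 0 < eps -> exists d M, 0 < d /\
     forall a b, 0 < a < d -> M < b ->
     exists y, is_RInt f a b y /\ Rabs (y - l) < eps) ->
  is_RInt_0_infty f l.
Proof.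
  intros H P [eps heps].
  destruct (H eps (cond_pos eps)) as (d & M & hd & h).
  apply Filter_prod with (Q := fun x => 0 < x < d) (R := fun x => M < x).
  - exists (mkposreal d hd); intros y hy hy0; split; [exact hy0|].
    change (Rabs (y - 0) < d) in hy; apply Rabs_lt_between in hy; lra.
  - exists M; intros x hx; exact hx.
  - intros a b ha hb; destruct (h a b ha hb) as (y & hy & hyl).
    exists y; split; [exact hy|]; apply heps; exact hyl.
Qed.

Lemma filterlim_at_right_0_linear (g : R -> R) (M l : R) :
  (forall x, 0 < x -> Rabs (g x - l) <= M * x) -> filterlim g (at_right 0) (locally l).
Proof.
  intros H; apply filterlim_locally; intros eps.
  assert (hM : 0 < Rabs M + 1) by (generalize (Rabs_pos M); lra).
  assert (hd : 0 < eps / (Rabs M + 1))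
    by (apply Rdiv_lt_0_compat; [apply cond_pos|exact hM]).
  exists (mkposreal _ hd); intros y hy hy0.
  change (Rabs (y - 0) < eps / (Rabs M + 1)) in hy; change (Rabs (g y - l) < eps).
  apply Rabs_lt_between in hy.
  assert (hy' : y < eps / (Rabs M + 1)) by lra.
  apply Rlt_div_r in hy'; [|exact hM].
  apply Rle_lt_trans with (1 := H y hy0).
  generalize (Rle_abs M); intros; nra.
Qed.

Lemma filterlim_p_infty_inv (g : R -> R) (M l : R) :
  (forall x, 0 < x -> Rabs (g x - l) <= M / x) ->
  filterlim g (Rbar_locally p_infty) (locally l).
Proof.
  intros H; apply filterlim_locally; intros eps.
  exists (Rabs M / eps); intros y hy.
  assert (he := cond_pos eps).
  assert (hy0 : 0 < y).
  { apply Rle_lt_trans with (2 := hy).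
    apply Rdiv_le_0_compat; [apply Rabs_pos|exact he]. }
  change (Rabs (g y - l) < eps).
  apply Rle_lt_trans with (1 := H y hy0).
  apply Rlt_div_l in hy; [|exact he].
  apply Rlt_div_l; [exact hy0|].
  generalize (Rle_abs M); lra.
Qed.

Lemma is_RInt_0_infty_primitive (F f : R -> R) (la lb : R) :
  (forall x, 0 < x -> is_derive F x (f x)) ->
  (forall x, 0 < x -> continuous f x) ->
  filterlim F (at_right 0) (locally la) ->
  filterlim F (Rbar_locally p_infty) (locally lb) ->
  is_RInt_0_infty f (lb - la).
Proof.
  intros hF hf ha hb.
  apply is_RInt_0_infty_ext with (Derive F).
  { intros x hx; apply is_derive_unique, hF, hx. }
  apply is_RInt_gen_Derive; try assumption.
  - apply filter_prod_pos; intros x hx; eexists; apply hF, hx.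
  - apply (filter_prod_pos (continuous (Derive F))); intros x hx.
    apply continuous_ext_loc with f; [|apply hf, hx].
    exists (mkposreal x hx); intros y hy.
    symmetry; apply is_derive_unique, hF.
    change (Rabs (y - x) < x) in hy; apply Rabs_lt_between in hy; lra.
Qed.

Lemma is_RInt_0_infty_comp_scal (f : R -> R) (a l : R) :
  0 < a -> is_RInt_0_infty f l ->
  is_RInt_0_infty (fun x => a * f (a * x)) l.
Proof.
  intros ha H P hP.
  destruct (H P hP) as [Q S hQ hS h].
  apply Filter_prod with (Q := fun x => Q (a * x)) (R := fun x => S (a * x)).
  - destruct hQ as [d hd].
    assert (hda : 0 < d / a) by (apply Rdiv_lt_0_compat; [apply cond_pos|exact ha]).
    exists (mkposreal _ hda); intros y hy hy0; apply hd; [|now apply Rmult_lt_0_compat].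
    change (Rabs (y - 0) < d / a) in hy; change (Rabs (a * y - 0) < d).
    apply Rabs_lt_between in hy.
    assert (hy' : y < d / a) by lra.
    apply Rlt_div_r in hy'; [|exact ha].
    assert (0 < a * y) by now apply Rmult_lt_0_compat.
    apply Rabs_lt_between; lra.
  - destruct hS as [M hM]; exists (M / a); intros x hx; apply hM.
    apply Rlt_div_l in hx; lra.
  - intros x y hx hy; destruct (h _ _ hx hy) as (v & hv & hPv).
    exists v; split; [|exact hPv]; simpl in *.
    apply is_RInt_ext with (fun x => scal a (f (a * x + 0))).
    { intros z _; unfold scal; simpl; unfold mult; simpl; now rewrite Rplus_0_r. }
    apply (is_RInt_comp_lin f a 0).
    now rewrite !Rplus_0_r.
Qed.

Lemma is_RInt_0_infty_scal (c : R) (f : R -> R) (l : R) :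
  is_RInt_0_infty f l -> is_RInt_0_infty (fun x => c * f x) (c * l).
Proof. exact (is_RInt_gen_scal (V := R_NormedModule) f c l). Qed.

Lemma is_RInt_0_infty_sum (c l : nat -> R) (f : nat -> R -> R) (n : nat) :
  (forall k, (k <= n)%nat -> is_RInt_0_infty (fun x => c k * f k x) (l k)) ->
  is_RInt_0_infty (fun x => sum_f_R0 (fun k => c k * f k x) n) (sum_f_R0 l n).
Proof.
  induction n as [|n IH]; intros H; simpl.
  - apply (H 0%nat); lia.
  - apply (is_RInt_gen_plus (V := R_NormedModule)); [apply IH; intros k hk|]; apply H; lia.
Qed.

Lemma continuous_div_pow (f : R -> R) (i : nat) (x : R) :
  x <> 0 -> continuous f x -> continuous (fun y => f y / y ^ i) x.
Proof.
  intros hx hf.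
  apply (continuous_mult f (fun y => / y ^ i)); [exact hf|].
  apply continuous_Rinv_comp; [|now apply pow_nonzero].
  apply ex_derive_continuous_R.
  now auto_derive.
Qed.

(** The derivative of [F x / x^i] is the difference of the two integrands, and
    the bound on [F] says that [F x / x^i] is at most [M x] near [0] and at most
    [M / x] near infinity, so its boundary values vanish.  Since that difference
    has integral [0] whether or not either side converges, the two integrals
    transfer to each other in both directions. *)
Lemma is_RInt_0_infty_by_parts (F F' : R -> R) (i : nat) (M l : R) :
  (1 <= i)%nat ->
  (forall x, 0 < x -> is_derive F x (F' x)) ->
  (forall x, 0 < x -> continuous F' x) ->
  (forall x, 0 < x -> Rabs (F x) <= M * Rmin 1 (Rabs x) ^ S i) ->
  (is_RInt_0_infty (fun x => F' x / x ^ i) l <->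
   is_RInt_0_infty (fun x => INR i * (F x / x ^ S i)) l).
Proof.
  intros hi hF hF' hM.
  assert (hb : forall x, 0 < x ->
    Rabs (F x / x ^ i) <= M * x /\ Rabs (F x / x ^ i) <= M / x).
  { intros x hx.
    assert (hu : 0 < Rmin 1 x <= 1 /\ Rmin 1 x <= x).
    { repeat split; [apply Rmin_glb_lt; lra|apply Rmin_l|apply Rmin_r]. }
    set (u := Rmin 1 x) in *.
    assert (hM0 : 0 <= M).
    { specialize (hM x hx); rewrite (Rabs_right x) in hM by lra; fold u in hM.
      assert (0 < u ^ S i) by (apply pow_lt; lra).
      generalize (Rabs_pos (F x)); intros; nra. }
    assert (hxi : 0 < x ^ i) by now apply pow_lt.
    assert (hq : 0 < u / x <= 1).
    { split; [apply Rdiv_lt_0_compat; lra|].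
      apply Rle_div_l; lra. }
    assert (hF1 : Rabs (F x / x ^ i) <= M * (u * (u / x) ^ i)).
    { unfold Rdiv; rewrite Rabs_mult, Rabs_inv, (Rabs_right (x ^ i)) by lra.
      rewrite Rpow_mult_distr, pow_inv.
      apply Rle_trans with (M * u ^ S i * / x ^ i).
      - apply Rmult_le_compat_r; [left; now apply Rinv_0_lt_compat|].
        specialize (hM x hx); now rewrite (Rabs_right x) in hM by lra.
      - right; simpl; ring. }
    assert (hp : 0 <= (u / x) ^ i <= u / x).
    { split; [apply pow_le; lra|].
      destruct i as [|i]; [lia|]; simpl.
      apply Rle_trans with (u / x * 1); [|lra].
      apply Rmult_le_compat_l; [lra|].
      rewrite <- (pow1 i); apply pow_incr; lra. }
    split; apply Rle_trans with (1 := hF1).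
    - apply Rmult_le_compat_l; [exact hM0|]; nra.
    - unfold Rdiv at 2; apply Rmult_le_compat_l; [exact hM0|].
      apply Rle_trans with (1 * (u / x)); [nra|].
      rewrite Rmult_1_l; unfold Rdiv; rewrite <- (Rmult_1_l (/ x)) at 2.
      apply Rmult_le_compat_r; [left; now apply Rinv_0_lt_compat|lra]. }
  assert (hD : is_RInt_0_infty
    (fun x => F' x / x ^ i - INR i * (F x / x ^ S i)) 0).
  { replace 0 with (0 - 0) at 2 by ring.
    apply is_RInt_0_infty_primitive with (fun x => F x / x ^ i).
    - intros x hx.
      assert (hx' : x <> 0) by lra.
      assert (hxi : x ^ i <> 0) by now apply pow_nonzero.
      assert (hd : is_derive (fun x => x ^ i) x (INR i * x ^ pred i)).
      { apply is_derive_Reals, derivable_pt_lim_pow. }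
      evar_last; [exact (is_derive_div F _ x _ _ (hF x hx) hd hxi)|].
      destruct i as [|i]; [lia|]; simpl pred; simpl pow in *.
      assert (x ^ i <> 0) by now apply pow_nonzero.
      field; auto.
    - intros x hx.
      assert (hx' : x <> 0) by lra.
      apply (continuous_minus (V := R_NormedModule)).
      + apply continuous_div_pow; [exact hx'|apply hF', hx].
      + apply (continuous_scal_r (V := R_NormedModule) (INR i)).
        apply continuous_div_pow; [exact hx'|].
        apply ex_derive_continuous_R.
        exists (F' x); exact (hF x hx).
    - apply filterlim_at_right_0_linear with M; intros x hx; rewrite Rminus_0_r; apply hb, hx.
    - apply filterlim_p_infty_inv with M; intros x hx; rewrite Rminus_0_r; apply hb, hx. }
  split; intros H.
  - replace l with (l - 0) by ring.
    generalize (is_RInt_gen_minus (V := R_NormedModule) _ _ _ _ H hD).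
    apply is_RInt_0_infty_ext; intros x _; unfold minus, plus, opp; simpl; ring.
  - replace l with (l + 0) by ring.
    generalize (is_RInt_gen_plus (V := R_NormedModule) _ _ _ _ H hD).
    apply is_RInt_0_infty_ext; intros x _; unfold plus; simpl; ring.
Qed.

(** * The Dirichlet integral, from the Fejer kernel *)

(** Sums of cosines rather than the quotients [sin ((2N+1) x) / sin x] and
    [(sin (N x) / sin x)^2]: they make sense at [0] and integrate term by term. *)
Fixpoint dirichlet (N : nat) (x : R) : R :=
  match N with
  | O => 1
  | S N => dirichlet N x + 2 * cos (2 * INR (S N) * x)
  end.

Fixpoint fejer (N : nat) (x : R) : R :=
  match N with
  | O => 0
  | S N => fejer N x + dirichlet N x
  end.

Lemma sin_mult_dirichlet N x :
  sin x * dirichlet N x = sin ((2 * INR N + 1) * x).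
Proof.
  induction N as [|N IH].
  - simpl; rewrite Rmult_0_r, Rplus_0_l, Rmult_1_l; ring.
  - change (dirichlet (S N) x) with (dirichlet N x + 2 * cos (2 * INR (S N) * x)).
    rewrite Rmult_plus_distr_l, IH, S_INR.
    set (t := 2 * (INR N + 1) * x).
    replace ((2 * INR N + 1) * x) with (t - x) by (unfold t; ring).
    replace ((2 * (INR N + 1) + 1) * x) with (t + x) by (unfold t; ring).
    rewrite sin_minus, sin_plus; ring.
Qed.

Lemma sin_sqr_mult_fejer N x : sin x ^ 2 * fejer N x = sin (INR N * x) ^ 2.
Proof.
  induction N as [|N IH].
  - simpl; rewrite Rmult_0_l, sin_0; ring.
  - change (fejer (S N) x) with (fejer N x + dirichlet N x).
    rewrite Rmult_plus_distr_l, IH.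
    replace (sin x ^ 2 * dirichlet N x) with (sin x * (sin x * dirichlet N x)) by ring.
    rewrite sin_mult_dirichlet, S_INR.
    set (t := INR N * x); set (u := (INR N + 1) * x).
    replace ((2 * INR N + 1) * x) with (u + t) by (unfold u, t; ring).
    replace (sin x) with (sin (u - t)) by (f_equal; unfold u, t; ring).
    rewrite sin_plus, sin_minus.
    generalize (sin2_cos2 t) (sin2_cos2 u); unfold Rsqr; intros h1 h2.
    apply Rminus_diag_uniq.
    transitivity (sin u ^ 2 * (sin t * sin t + cos t * cos t - 1)
      - sin t ^ 2 * (sin u * sin u + cos u * cos u - 1)); [ring|].
    rewrite h1, h2; ring.
Qed.

Lemma is_RInt_dirichlet N : is_RInt (dirichlet N) 0 (PI / 2) (PI / 2).
Proof.
  induction N as [|N IH].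
  - evar_last; [exact (is_RInt_const 0 (PI / 2) 1)|].
    unfold scal; simpl; unfold mult; simpl; ring.
  - assert (hN : INR (S N) <> 0) by (apply not_0_INR; lia).
    evar_last.
    + apply (is_RInt_plus (V := R_NormedModule)); [exact IH|].
      apply (is_RInt_derive (fun x => sin (2 * INR (S N) * x) / INR (S N))
               (fun x => 2 * cos (2 * INR (S N) * x))).
      * intros x _; clear IH; revert hN; generalize (INR (S N)); intros m hN.
        auto_derive; [exact I|]; field; exact hN.
      * intros x _; apply ex_derive_continuous_R.
        now auto_derive.
    + unfold minus, plus, opp; simpl plus; cbv beta.
      replace (2 * INR (S N) * (PI / 2)) with (0 + INR (S N) * PI) by field.
      rewrite Rmult_0_r, sin_0.
      rewrite (sin_eq_0_1 (0 + INR (S N) * PI)).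
      * simpl; field; exact hN.
      * exists (Z.of_nat (S N)); rewrite <- INR_IZR_INZ; ring.
Qed.

Lemma is_RInt_fejer N : is_RInt (fejer N) 0 (PI / 2) (INR N * (PI / 2)).
Proof.
  induction N as [|N IH].
  - evar_last; [exact (is_RInt_const 0 (PI / 2) 0)|].
    unfold scal; simpl; unfold mult; simpl; ring.
  - evar_last.
    + apply (is_RInt_plus (V := R_NormedModule)); [exact IH|apply is_RInt_dirichlet].
    + rewrite S_INR; unfold plus; simpl; ring.
Qed.

Lemma continuous_fejer N x : continuous (fejer N) x.
Proof.
  assert (hd : forall M, continuous (dirichlet M) x).
  { induction M as [|M IH].
    - apply continuous_const.
    - apply (continuous_plus (V := R_NormedModule)); [exact IH|].
      apply ex_derive_continuous_R.
      now auto_derive. }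
  induction N as [|N IH]; [apply continuous_const|].
  now apply (continuous_plus (V := R_NormedModule)).
Qed.

Lemma fejer_le N x : fejer N x <= INR N ^ 2.
Proof.
  assert (hd : forall M, dirichlet M x <= 2 * INR M + 1).
  { induction M as [|M IH]; [simpl; lra|].
    change (dirichlet (S M) x) with (dirichlet M x + 2 * cos (2 * INR (S M) * x)).
    rewrite S_INR at 2; generalize (COS_bound (2 * INR (S M) * x)); lra. }
  induction N as [|N IH]; [simpl; lra|].
  change (fejer (S N) x) with (fejer N x + dirichlet N x).
  rewrite S_INR; specialize (hd N); nra.
Qed.

Lemma Rabs_sin_le x : Rabs (sin x) <= Rabs x.
Proof.
  assert (H : forall y, 0 <= y -> Rabs (sin y) <= y).
  { intros y [hy|<-]; [|rewrite sin_0, Rabs_R0; lra].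
    destruct (Rle_lt_dec y 1) as [h|h].
    - assert (hp := PI2_1).
      rewrite Rabs_right; [left; now apply sin_lt_x|].
      apply Rle_ge, sin_ge_0; lra.
    - apply Rle_trans with 1; [apply Rabs_le, SIN_bound|lra]. }
  destruct (Rle_lt_dec 0 x) as [h|h].
  - rewrite (Rabs_right x) by lra; now apply H.
  - rewrite (Rabs_left x) by lra; rewrite <- (Rabs_Ropp (sin x)), <- sin_neg; apply H; lra.
Qed.

Lemma Rabs_sin_pow_le n x : Rabs (sin x ^ n) <= Rmin 1 (Rabs x) ^ n.
Proof.
  rewrite <- RPow_abs; apply pow_incr; split; [apply Rabs_pos|].
  apply Rmin_glb; [apply Rabs_le, SIN_bound|apply Rabs_sin_le].
Qed.

Lemma sin_ge_cubic x : 0 <= x <= PI -> x - x ^ 3 / 6 <= sin x.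
Proof.
  intros [h0 h1]; destruct (sin_bound x 0 h0 h1) as [h _].
  unfold sin_approx, sin_term in h; simpl in h; simpl; lra.
Qed.

(** The two terms are [sin (N x)^2] times [1 / sin^2 x] and [1 / x^2], and
    [1 / sin^2 x - 1 / x^2] stays bounded at [0] because the leading poles
    cancel.  What matters is that the bound is uniform in [N]. *)
Lemma fejer_near_sinc N x :
  0 < x <= PI / 2 ->
  0 <= fejer N x - (sin (INR N * x) / x) ^ 2 <= 3.
Proof.
  intros hx.
  assert (hp := PI_4); assert (hx2 : x ^ 2 <= 4) by nra.
  assert (hs1 := sin_ge_cubic x ltac:(lra)).
  assert (hs2 := sin_lt_x x ltac:(lra)).
  assert (hs3 : x / 3 <= sin x) by nra.
  assert (hs : 0 < sin x) by lra.
  set (S2 := sin (INR N * x) ^ 2).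
  assert (hS : 0 <= S2 <= 1).
  { unfold S2; generalize (SIN_bound (INR N * x)); intros; nra. }
  replace (fejer N x - (sin (INR N * x) / x) ^ 2)
    with (S2 * ((x ^ 2 - sin x ^ 2) / (x ^ 2 * sin x ^ 2))).
  2:{ replace ((sin (INR N * x) / x) ^ 2) with (S2 / x ^ 2) by (unfold S2; field; lra).
      unfold S2; rewrite <- (sin_sqr_mult_fejer N x); field; lra. }
  assert (hden : 0 < x ^ 2 * sin x ^ 2) by (apply Rmult_lt_0_compat; apply pow_lt; lra).
  assert (hnum : 0 <= x ^ 2 - sin x ^ 2) by nra.
  assert (h : 0 <= (x ^ 2 - sin x ^ 2) / (x ^ 2 * sin x ^ 2) <= 3).
  { split; [now apply Rdiv_le_0_compat|].
    apply Rle_div_l; [exact hden|].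
    (* The numerator is at most [(x^3/6) (2x)], while [sin^2 x >= x^2/9]. *)
    assert (ha : x ^ 2 - sin x ^ 2 <= x ^ 3 / 6 * (2 * x)).
    { replace (x ^ 2 - sin x ^ 2) with ((x - sin x) * (x + sin x)) by ring.
      apply Rmult_le_compat; lra. }
    assert (hb : x ^ 2 / 9 <= sin x ^ 2) by nra.
    apply Rle_trans with (1 := ha).
    apply Rle_trans with (3 * (x ^ 2 * (x ^ 2 / 9))); [right; field|].
    apply Rmult_le_compat_l; [lra|].
    apply Rmult_le_compat_l; [nra|exact hb]. }
  nra.
Qed.

Lemma continuous_sinc_sqr x : x <> 0 -> continuous (fun x => sin x ^ 2 / x ^ 2) x.
Proof.
  intros hx; apply (continuous_div_pow (fun x => sin x ^ 2)); [exact hx|].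
  apply ex_derive_continuous_R.
  now auto_derive.
Qed.

Lemma ex_RInt_sinc_sqr a b :
  0 < a -> 0 < b -> ex_RInt (fun x => sin x ^ 2 / x ^ 2) a b.
Proof.
  intros ha hb; apply (ex_RInt_continuous (V := R_CompleteNormedModule)).
  intros z hz; apply continuous_sinc_sqr.
  assert (0 < Rmin a b) by now apply Rmin_glb_lt. lra.
Qed.

(** After the substitution [x -> N x], [N] times the integral is that of
    [(sin (N x) / x)^2] over [[a/N, pi/2]], where the Fejer kernel is within [3].
    The part of the kernel below [a/N], which is at most [N^2], accounts for the
    error [a]; the bound [3] accounts for the error in [1/N]. *)
Lemma RInt_sinc_sqr_bounds N a :
  (1 <= N)%nat -> 0 < a <= INR N * (PI / 2) ->
  PI / 2 - a - 3 * (PI / 2) / INR N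
    <= RInt (fun x => sin x ^ 2 / x ^ 2) a (INR N * (PI / 2)) <= PI / 2.
Proof.
  intros hN ha.
  set (J := RInt _ _ _).
  assert (hp := PI_RGT_0).
  assert (hn : 0 < INR N) by (apply lt_0_INR; lia).
  set (d := a / INR N).
  assert (hd0 : 0 < d) by (apply Rdiv_lt_0_compat; lra).
  assert (hd1 : d <= PI / 2) by (apply Rle_div_l; lra).
  assert (had : INR N * d = a) by (unfold d; field; lra).
  assert (hJ : is_RInt (fun x => (sin (INR N * x) / x) ^ 2) d (PI / 2) (INR N * J)).
  { apply is_RInt_ext with (fun y => scal (INR N) (scal (INR N)
      (sin (INR N * y + 0) ^ 2 / (INR N * y + 0) ^ 2))).
    { rewrite Rmin_left, Rmax_right by lra; intros x hx.
      unfold scal; simpl; unfold mult; simpl; rewrite !Rplus_0_r; field; lra. }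
    apply (is_RInt_scal (V := R_NormedModule) _ _ _ (INR N) J).
    apply (is_RInt_comp_lin (V := R_NormedModule) (fun x => sin x ^ 2 / x ^ 2)).
    rewrite !Rplus_0_r, had.
    apply (RInt_correct (V := R_CompleteNormedModule)), ex_RInt_sinc_sqr; lra. }
  assert (hex : forall u v, ex_RInt (fejer N) u v).
  { intros u v; apply (ex_RInt_continuous (V := R_CompleteNormedModule)).
    intros z _; apply continuous_fejer. }
  set (K0 := RInt (fejer N) 0 d); set (K1 := RInt (fejer N) d (PI / 2)).
  assert (hK0 := RInt_correct (V := R_CompleteNormedModule) _ _ _ (hex 0 d)).
  assert (hK1 := RInt_correct (V := R_CompleteNormedModule) _ _ _ (hex d (PI / 2))).
  fold K0 in hK0; fold K1 in hK1.
  assert (hK : K0 + K1 = INR N * (PI / 2)).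
  { rewrite <- (is_RInt_unique _ _ _ _ (is_RInt_fejer N)).
    symmetry; apply is_RInt_unique.
    exact (is_RInt_Chasles (V := R_NormedModule) _ _ _ _ _ _ hK0 hK1). }
  assert (hc : forall u v c, is_RInt (fun _ => c) u v ((v - u) * c)).
  { intros u v c; exact (is_RInt_const (V := R_NormedModule) u v c). }
  assert (h1 : K0 <= (d - 0) * INR N ^ 2).
  { apply (is_RInt_le (fejer N) (fun _ => INR N ^ 2) 0 d); [lra|exact hK0|apply hc|].
    intros x _; apply fejer_le. }
  assert (h0 : 0 <= K0).
  { replace 0 with ((d - 0) * 0) by ring.
    apply (is_RInt_le (fun _ => 0) (fejer N) 0 d); [lra|apply hc|exact hK0|].
    intros x hx; generalize (fejer_near_sinc N x ltac:(lra)).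
    generalize (pow2_ge_0 (sin (INR N * x) / x)); lra. }
  assert (h2 : INR N * J <= K1).
  { apply (is_RInt_le _ _ _ _ _ _ hd1 hJ hK1).
    intros x hx; generalize (fejer_near_sinc N x ltac:(lra)); lra. }
  assert (h3 : K1 <= INR N * J + (PI / 2 - d) * 3).
  { apply (is_RInt_le _ _ _ _ _ _ hd1 hK1
      (is_RInt_plus (V := R_NormedModule) _ _ _ _ _ _ hJ (hc d (PI / 2) 3))).
    intros x hx; generalize (fejer_near_sinc N x ltac:(lra)); unfold plus; simpl; lra. }
  rewrite Rminus_0_r in h1.
  replace (d * INR N ^ 2) with (INR N * a) in h1 by (rewrite <- had; ring).
  split.
  - apply Rmult_le_reg_l with (INR N); [exact hn|].
    replace (INR N * (PI / 2 - a - 3 * (PI / 2) / INR N))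
      with (INR N * (PI / 2) - INR N * a - 3 * (PI / 2)) by (field; lra).
    nra.
  - apply Rmult_le_reg_l with (INR N); [exact hn|]; lra.
Qed.

(** The integrand is nonnegative, so the integral from [a] to [b] is squeezed
    between those ending at multiples of [pi/2] below and above [b]. *)
Lemma is_RInt_0_infty_sinc_sqr :
  is_RInt_0_infty (fun x => sin x ^ 2 / x ^ 2) (PI / 2).
Proof.
  assert (hp := PI_RGT_0).
  assert (hmono : forall a b c, 0 < a -> a <= b -> b <= c ->
    RInt (fun x => sin x ^ 2 / x ^ 2) a b <= RInt (fun x => sin x ^ 2 / x ^ 2) a c).
  { intros a b c ha hab hbc.
    assert (hc := RInt_Chasles (V := R_CompleteNormedModule)
      (fun x => sin x ^ 2 / x ^ 2) a b c
      (ex_RInt_sinc_sqr a b ltac:(lra) ltac:(lra))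
      (ex_RInt_sinc_sqr b c ltac:(lra) ltac:(lra))).
    rewrite <- hc; unfold plus; simpl.
    assert (0 <= RInt (fun x => sin x ^ 2 / x ^ 2) b c); [|simpl in *; lra].
    apply RInt_ge_0; [exact hbc|apply ex_RInt_sinc_sqr; lra|].
    intros x hx; apply Rdiv_le_0_compat; [apply pow2_ge_0|apply pow_lt; lra]. }
  assert (hN : forall M, exists N, (1 <= N)%nat /\ M < INR N).
  { intros M; destruct (INR_unbounded (Rmax 1 M)) as [N hM].
    exists N; split.
    - apply INR_le; simpl; generalize (Rmax_l 1 M); lra.
    - generalize (Rmax_r 1 M); lra. }
  apply is_RInt_0_infty_intro; intros eps heps.
  destruct (hN (6 * PI / eps)) as (N & hN1 & hNe).
  assert (hn : 1 <= INR N) by (apply (le_INR 1); exact hN1).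
  exists (Rmin (eps / 2) (PI / 2)), (INR N * (PI / 2)).
  split; [apply Rmin_glb_lt; lra|].
  intros a b [ha0 ha] hb.
  assert (ha1 : a < eps / 2) by (apply Rlt_le_trans with (1 := ha), Rmin_l).
  assert (ha2 : a < PI / 2) by (apply Rlt_le_trans with (1 := ha), Rmin_r).
  assert (haN : a <= INR N * (PI / 2)) by nra.
  exists (RInt (fun x => sin x ^ 2 / x ^ 2) a b); split.
  { apply (RInt_correct (V := R_CompleteNormedModule)), ex_RInt_sinc_sqr; nra. }
  destruct (RInt_sinc_sqr_bounds N a hN1 ltac:(lra)) as [hlow _].
  assert (hlow2 := hmono a _ b ha0 haN ltac:(lra)).
  destruct (hN (b / (PI / 2))) as (N' & hN1' & hNb).
  apply Rlt_div_l in hNb; [|lra].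
  destruct (RInt_sinc_sqr_bounds N' a hN1' ltac:(lra)) as [_ hup].
  assert (hup2 := hmono a b (INR N' * (PI / 2)) ha0 ltac:(lra) ltac:(lra)).
  assert (hq : 3 * (PI / 2) / INR N < eps / 2).
  { apply Rlt_div_l in hNe; [|exact heps].
    apply Rlt_div_l; [lra|]; nra. }
  apply Rabs_lt_between; lra.
Qed.

Lemma is_RInt_0_infty_sin_div a :
  is_RInt_0_infty (fun x => sin (a * x) / x) (sign a * (PI / 2)).
Proof.
  (* The derivative of [sin^2 x] is [sin (2 x)]: this is the frequency [2], and the
     others follow by rescaling. *)
  assert (h2 : is_RInt_0_infty (fun x => 2 * sin x * cos x / x ^ 1) (PI / 2)).
  { apply (is_RInt_0_infty_by_parts (fun x => sin x ^ 2) _ 1 1); [lia| | | |].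
    - intros x _; auto_derive; [exact I|ring].
    - intros x _; apply ex_derive_continuous_R.
      now auto_derive.
    - intros x _; rewrite Rmult_1_l; apply Rabs_sin_pow_le.
    - generalize is_RInt_0_infty_sinc_sqr; apply is_RInt_0_infty_ext; intros x _.
      simpl; ring. }
  assert (hpos : forall b, 0 < b -> is_RInt_0_infty (fun x => sin (b * x) / x) (PI / 2)).
  { intros b hb.
    assert (hb2 : 0 < b / 2) by lra.
    generalize (is_RInt_0_infty_comp_scal _ _ _ hb2 h2).
    apply is_RInt_0_infty_ext; intros x hx.
    replace (b * x) with (2 * (b / 2 * x)) by field.
    rewrite sin_2a; field; lra. }
  destruct (Rtotal_order a 0) as [h|[h|h]].
  - rewrite sign_eq_m1 by exact h.
    assert (h' : 0 < - a) by lra.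
    generalize (is_RInt_0_infty_scal (-1) _ _ (hpos (- a) h')).
    apply is_RInt_0_infty_ext; intros x hx.
    replace (- a * x) with (- (a * x)) by ring; rewrite sin_neg; field; lra.
  - rewrite h, sign_0.
    generalize (is_RInt_0_infty_scal 0 _ _ (hpos 1 Rlt_0_1)).
    apply is_RInt_0_infty_ext; intros x hx.
    rewrite (Rmult_0_l x), sin_0; field; lra.
  - rewrite sign_eq_1, Rmult_1_l by exact h; now apply hpos.
Qed.

(** * Derivatives of the powers of the sine *)

Definition sin_pow_coef (n j k : nat) : R :=
  (-1) ^ k * Binomial.C n k * (INR n - 2 * INR k) ^ j.

Definition dsin_pow (n j : nat) (x : R) : R :=
  sum_f_R0 (fun k => sin_pow_coef n j k / 2 ^ n
     * cos ((INR n - 2 * INR k) * x - (INR n - INR j) * (PI / 2))) n.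

Lemma sum_pascal (g : nat -> R) (n : nat) :
  sum_f_R0 (fun k => Binomial.C (S n) k * g k) (S n)
  = sum_f_R0 (fun k => Binomial.C n k * (g k + g (S k))) n.
Proof.
  (* [Binomial.C n (S n)] is not [0], so Pascal's rule is applied only strictly
     below the diagonal and the last term is kept apart. *)
  assert (H : forall m, (m <= n)%nat ->
    sum_f_R0 (fun k => Binomial.C n k * (g k + g (S k))) m
    = sum_f_R0 (fun k => Binomial.C (S n) k * g k) m + Binomial.C n m * g (S m)).
  { induction m as [|m IH]; intros hm.
    - simpl; rewrite !C_n_0; ring.
    - rewrite !tech5, IH by lia.
      rewrite <- (pascal n m) by lia; ring. }
  rewrite H, tech5 by lia.
  now rewrite !C_n_n.
Qed.

(** [sin^n] as the real part of [((e^(ix) - e^(-ix)) / 2i)^n].  Multiplying one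
    term by [sin x] splits it into two terms whose frequencies differ by [2], and
    Pascal's rule collects them. *)
Lemma dsin_pow_0 n x : dsin_pow n 0 x = sin x ^ n.
Proof.
  induction n as [|n IH].
  - unfold dsin_pow, sin_pow_coef; simpl; rewrite C_n_0.
    replace ((0 - 2 * 0) * x - (0 - 0) * (PI / 2)) with 0 by field.
    rewrite cos_0; field.
  - unfold dsin_pow, sin_pow_coef in *.
    rewrite (sum_eq _ (fun k => Binomial.C (S n) k *
      ((-1) ^ k / 2 ^ S n * cos ((INR (S n) - 2 * INR k) * x - INR (S n) * (PI / 2))))).
    2:{ intros k _; simpl (INR 0); rewrite Rminus_0_r; simpl pow.
        field; apply pow_nonzero; lra. }
    change (sin x ^ S n) with (sin x * sin x ^ n).
    rewrite sum_pascal, <- IH, scal_sum.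
    apply sum_eq; intros k _.
    rewrite !S_INR; simpl (INR 0).
    set (t := (INR n - 2 * INR k) * x - INR n * (PI / 2)).
    replace ((INR n - 2 * INR k) * x - (INR n - 0) * (PI / 2)) with t by (unfold t; ring).
    replace ((INR n + 1 - 2 * INR k) * x - (INR n + 1) * (PI / 2))
      with (- (PI / 2 - (t + x))) by (unfold t; ring).
    replace ((INR n + 1 - 2 * (INR k + 1)) * x - (INR n + 1) * (PI / 2))
      with (- (PI / 2 - (t - x))) by (unfold t; ring).
    rewrite !cos_neg, !cos_shift, sin_plus, sin_minus; simpl pow.
    field; apply pow_nonzero; lra.
Qed.

Lemma is_derive_sum_f_R0 (f f' : nat -> R -> R) (n : nat) (x : R) :
  (forall k, is_derive (f k) x (f' k x)) ->
  is_derive (fun y => sum_f_R0 (fun k => f k y) n) x (sum_f_R0 (fun k => f' k x) n).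
Proof.
  intros H; induction n as [|n IH]; simpl; [apply H|].
  now apply (is_derive_plus (V := R_NormedModule)).
Qed.

Lemma is_derive_dsin_pow n j x : is_derive (dsin_pow n j) x (dsin_pow n (S j) x).
Proof.
  unfold dsin_pow, sin_pow_coef.
  apply (is_derive_sum_f_R0
    (fun k y => (-1) ^ k * Binomial.C n k * (INR n - 2 * INR k) ^ j / 2 ^ n
       * cos ((INR n - 2 * INR k) * y - (INR n - INR j) * (PI / 2)))
    (fun k y => (-1) ^ k * Binomial.C n k * (INR n - 2 * INR k) ^ S j / 2 ^ n
       * cos ((INR n - 2 * INR k) * y - (INR n - INR (S j)) * (PI / 2)))).
  intros k; auto_derive; [exact I|].
  rewrite S_INR.
  set (t := (INR n - 2 * INR k) * x - (INR n - INR j) * (PI / 2)).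
  replace ((INR n - 2 * INR k) * x - (INR n - (INR j + 1)) * (PI / 2))
    with (PI / 2 + t) by (unfold t; ring).
  rewrite cos_plus, cos_PI2, sin_PI2; simpl pow.
  match goal with |- context [sin ?u] =>
    replace (sin u) with (sin t) by (f_equal; unfold t; field)
  end.
  field; apply pow_nonzero; lra.
Qed.

Lemma dsin_pow_1 n x : dsin_pow (S n) 1 x = INR (S n) * sin x ^ n * cos x.
Proof.
  rewrite <- (is_derive_unique _ _ _ (is_derive_dsin_pow (S n) 0 x)).
  apply is_derive_unique.
  apply is_derive_ext with (fun y => sin y ^ S n); [intros; now rewrite dsin_pow_0|].
  auto_derive; [exact I|].
  change (1 * cos x * (INR (S n) * sin x ^ n) = INR (S n) * sin x ^ n * cos x); ring.
Qed.

(** The equation [(sin^n)'' = n (n-1) sin^(n-2) - n^2 sin^n], differentiated [j]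
    times. *)
Lemma dsin_pow_SS n j x :
  dsin_pow (S (S n)) (S (S j)) x
  = INR (S (S n)) * INR (S n) * dsin_pow n j x
    - INR (S (S n)) ^ 2 * dsin_pow (S (S n)) j x.
Proof.
  revert x; induction j as [|j IH]; intros x.
  - rewrite !dsin_pow_0.
    rewrite <- (is_derive_unique _ _ _ (is_derive_dsin_pow (S (S n)) 1 x)).
    apply is_derive_unique.
    apply is_derive_ext with (fun y => INR (S (S n)) * sin y ^ S n * cos y);
      [intros; now rewrite dsin_pow_1|].
    auto_derive; [exact I|].
    rewrite (S_INR (S n)).
    change ((INR (S n) + 1) * (1 * cos x * (INR (S n) * sin x ^ n)) * cos x
      + (INR (S n) + 1) * (sin x * sin x ^ n) * (1 * - sin x)
      = (INR (S n) + 1) * INR (S n) * sin x ^ n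
        - (INR (S n) + 1) ^ 2 * (sin x * (sin x * sin x ^ n))).
    generalize (INR (S n)); intros m.
    assert (h : cos x * cos x = 1 - sin x * sin x)
      by (generalize (sin2_cos2 x); unfold Rsqr; lra).
    transitivity ((m + 1) * m * sin x ^ n * (cos x * cos x)
                  - (m + 1) * (sin x * (sin x * sin x ^ n))); [ring|].
    rewrite h; ring.
  - rewrite <- (is_derive_unique _ _ _ (is_derive_dsin_pow (S (S n)) (S (S j)) x)).
    apply is_derive_unique.
    eapply is_derive_ext; [intros t; symmetry; apply IH|].
    apply (is_derive_minus (V := R_NormedModule)); apply is_derive_scal;
      apply is_derive_dsin_pow.
Qed.

Lemma pow_le_1_antitone (u : R) (m n : nat) :
  0 <= u <= 1 -> (m <= n)%nat -> u ^ n <= u ^ m.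
Proof.
  intros hu hmn; replace n with (m + (n - m))%nat by lia.
  rewrite pow_add; rewrite <- (Rmult_1_r (u ^ m)) at 2.
  apply Rmult_le_compat_l; [now apply pow_le|].
  rewrite <- (pow1 (n - m)); now apply pow_incr.
Qed.

(** One estimate serves both ends: boundedness at infinity, and a zero of order
    [n - j] at [0].  By [dsin_pow_SS], passing from [j] to [j + 2] derivatives
    lowers the order by [2] in the first term, and the second term vanishes to
    higher order still; this is why the induction carries two consecutive values of [j]. *)
Lemma dsin_pow_bound n j :
  (j <= n)%nat -> exists M, 0 <= M /\ forall x,
  Rabs (dsin_pow n j x) <= M * Rmin 1 (Rabs x) ^ (n - j).
Proof.
  revert n.
  assert (hu : forall x, 0 <= Rmin 1 (Rabs x) <= 1).
  { intros x; split; [apply Rmin_glb; [lra|apply Rabs_pos]|apply Rmin_l]. }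
  assert (H : forall j,
    (forall n, (j <= n)%nat -> exists M, 0 <= M /\ forall x,
      Rabs (dsin_pow n j x) <= M * Rmin 1 (Rabs x) ^ (n - j)) /\
    (forall n, (S j <= n)%nat -> exists M, 0 <= M /\ forall x,
      Rabs (dsin_pow n (S j) x) <= M * Rmin 1 (Rabs x) ^ (n - S j))).
  2:{ intros n hj; now apply H. }
  clear j; induction j as [|j [IH1 IH2]].
  - split; intros n hn.
    + exists 1; split; [lra|]; intros x.
      rewrite dsin_pow_0, Nat.sub_0_r, Rmult_1_l; apply Rabs_sin_pow_le.
    + destruct n as [|n]; [lia|]; exists (INR (S n)); split; [apply pos_INR|]; intros x.
      rewrite dsin_pow_1, !Rabs_mult, (Rabs_right (INR _)) by (apply Rle_ge, pos_INR).
      replace (S n - 1)%nat with n by lia.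
      assert (h1 := Rabs_sin_pow_le n x).
      assert (h2 : Rabs (cos x) <= 1) by apply Rabs_le, COS_bound.
      rewrite <- (Rmult_1_r (_ * Rmin _ _ ^ _)).
      apply Rmult_le_compat; [| apply Rabs_pos | | exact h2].
      * apply Rmult_le_pos; [apply pos_INR|apply Rabs_pos].
      * apply Rmult_le_compat_l; [apply pos_INR|exact h1].
  - split; [exact IH2|]; intros n hn.
    destruct n as [|[|n]]; [lia|lia|].
    destruct (IH1 n) as (M1 & hM1 & h1); [lia|].
    destruct (IH1 (S (S n))) as (M2 & hM2 & h2); [lia|].
    set (a := INR (S (S n)) * INR (S n)); set (b := INR (S (S n)) ^ 2).
    assert (ha : 0 <= a) by (apply Rmult_le_pos; apply pos_INR).
    assert (hb : 0 <= b) by (apply pow_le, pos_INR).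
    exists (a * M1 + b * M2); split.
    { apply Rplus_le_le_0_compat; now apply Rmult_le_pos. }
    intros x; rewrite dsin_pow_SS; fold a b.
    specialize (h1 x); specialize (h2 x); specialize (hu x).
    replace (S (S n) - S (S j))%nat with (n - j)%nat by lia.
    replace (S (S n) - j)%nat with (2 + (n - j))%nat in h2 by lia.
    set (u := Rmin 1 (Rabs x)) in *.
    assert (h2' : Rabs (dsin_pow (S (S n)) j x) <= M2 * u ^ (n - j)).
    { apply Rle_trans with (1 := h2), Rmult_le_compat_l; [exact hM2|].
      apply pow_le_1_antitone; [exact hu|lia]. }
    apply Rle_trans with (1 := Rabs_triang _ _).
    rewrite Rabs_Ropp, !Rabs_mult, (Rabs_right a), (Rabs_right b) by lra.
    nra.
Qed.

(** Pairing [k] with [n - k] leaves only the middle term, present for even [n];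
    for [n = 0] it is the only term, which is why it must vanish there too. *)
Lemma sum_fold_symmetric (n : nat) (h : nat -> R) :
  (forall k, (k <= n)%nat -> h (n - k)%nat = h k) ->
  (forall k, (2 * k = n)%nat -> h k = 0) ->
  sum_f_R0 h n = 2 * sum_f_R0 h ((n - 1) / 2).
Proof.
  revert h; induction n as [n IH] using (well_founded_induction lt_wf); intros h hs h0.
  destruct n as [|[|[|n]]].
  - simpl; rewrite (h0 0%nat); [ring|lia].
  - generalize (hs 0%nat ltac:(lia)); simpl; lra.
  - generalize (hs 0%nat ltac:(lia)) (h0 1%nat ltac:(lia)); simpl; lra.
  - assert (hdiv : ((S (S (S n)) - 1) / 2)%nat = S ((S n - 1) / 2)).
    { replace (S (S (S n)) - 1)%nat with (n + 1 * 2)%nat by lia.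
      rewrite Nat.div_add by lia; replace (S n - 1)%nat with n by lia; lia. }
    rewrite hdiv, (decomp_sum h (S ((S n - 1) / 2))) by lia.
    rewrite tech5, decomp_sum by lia; rewrite !Nat.pred_succ.
    rewrite (IH (S n)) with (h := fun i => h (S i)); [|lia| |].
    + assert (e := hs 0%nat ltac:(lia)); rewrite Nat.sub_0_r in e; rewrite e; ring.
    + intros k hk; rewrite <- (hs (S k)) by lia; f_equal; lia.
    + intros k hk; apply h0; lia.
Qed.

(** * A Frullani integral for the cosine *)

Lemma increment_le (g g' : R -> R) (u v B : R) :
  (forall t, Rmin u v <= t <= Rmax u v -> is_derive g t (g' t) /\ Rabs (g' t) <= B) ->
  Rabs (g v - g u) <= B * Rabs (v - u).
Proof.
  intros H.
  destruct (MVT_gen g u v g') as (c & hc & hcv).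
  - intros t ht; apply H; lra.
  - intros t ht; apply continuity_pt_filterlim.
    apply ex_derive_continuous_R.
    exists (g' t); now apply H.
  - rewrite hcv, Rabs_mult; apply Rmult_le_compat_r; [apply Rabs_pos|now apply H].
Qed.

(** The usual cosine integral up to an additive constant, which disappears from
    the differences used below. *)
Definition cos_integral (t : R) : R := RInt (fun u => cos u / u) 1 t.

Lemma is_derive_cos_integral t : 0 < t -> is_derive cos_integral t (cos t / t).
Proof.
  assert (hc : forall u, 0 < u -> continuous (fun u => cos u / u) u).
  { intros u hu; apply ex_derive_continuous_R.
    auto_derive; lra. }
  intros ht; apply (is_derive_RInt (V := R_NormedModule) (fun u => cos u / u) cos_integral 1 t).
  - exists (mkposreal t ht); intros y hy.
    change (Rabs (y - t) < t) in hy; apply Rabs_lt_between in hy.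
    apply (RInt_correct (V := R_CompleteNormedModule)).
    apply (ex_RInt_continuous (V := R_CompleteNormedModule)); intros z hz; apply hc.
    apply Rlt_le_trans with (2 := proj1 hz), Rmin_glb_lt; lra.
  - now apply hc.
Qed.

(** A primitive is [Ci (a x) - Ci x].  Near [0], [Ci t - ln t] has a bounded
    derivative, so this tends to [ln a]; near infinity, [Ci t - sin t / t] has the
    derivative [sin t / t^2], so it tends to [0]. *)
Lemma is_RInt_0_infty_frullani_cos a :
  0 < a -> is_RInt_0_infty (fun x => (cos (a * x) - cos x) / x) (- ln a).
Proof.
  intros ha; replace (- ln a) with (0 - ln a) by ring.
  set (m := Rmin 1 a).
  assert (hm : 0 < m /\ m <= 1 /\ m <= a).
  { repeat split; [apply Rmin_glb_lt; lra|apply Rmin_l|apply Rmin_r]. }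
  assert (hax : forall x, 0 < x -> 0 < a * x) by (intros; now apply Rmult_lt_0_compat).
  assert (hmin : forall x t, 0 < x -> Rmin x (a * x) <= t -> m * x <= t).
  { intros x t hx ht; apply Rle_trans with (2 := ht), Rmin_glb; nra. }
  assert (habs : forall x, 0 < x -> Rabs (a * x - x) = Rabs (a - 1) * x).
  { intros x hx; replace (a * x - x) with ((a - 1) * x) by ring.
    now rewrite Rabs_mult, (Rabs_right x) by lra. }
  apply is_RInt_0_infty_primitive with (fun x => cos_integral (a * x) - cos_integral x).
  - intros x hx; evar_last.
    + apply (is_derive_minus (V := R_NormedModule)); [|now apply is_derive_cos_integral].
      apply (is_derive_comp (V := R_NormedModule) cos_integral (fun x => a * x)).
      * now apply is_derive_cos_integral, hax.
      * apply is_derive_scal, is_derive_id.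
    + unfold minus, plus, opp, scal, one; simpl; unfold mult; simpl; field; lra.
  - intros x hx; apply ex_derive_continuous_R.
    auto_derive; lra.
  - apply filterlim_at_right_0_linear with (Rabs (a - 1)); intros x hx.
    rewrite <- habs, <- (Rmult_1_l (Rabs (a * x - x))) by exact hx.
    replace (cos_integral (a * x) - cos_integral x - ln a)
      with ((cos_integral (a * x) - ln (a * x)) - (cos_integral x - ln x))
      by (rewrite ln_mult by assumption; ring).
    apply (increment_le (fun t => cos_integral t - ln t) (fun t => (cos t - 1) / t)).
    intros t [ht _]; apply (hmin x t hx) in ht.
    assert (ht0 : 0 < t) by (apply Rlt_le_trans with (2 := ht); nra).
    split.
    + evar_last.
      * apply (is_derive_minus (V := R_NormedModule)); [now apply is_derive_cos_integral|].
        now apply is_derive_ln.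
      * unfold minus, plus, opp; simpl; field; lra.
    + (* [1 - cos t = 2 sin^2 (t/2) <= 2 |sin (t/2)| <= t] *)
      replace t with (2 * (t / 2)) at 1 by field; rewrite cos_2a_sin.
      set (s := sin (t / 2)).
      replace ((1 - 2 * s * s - 1) / t) with (- (2 * (s * s) / t)) by (field; lra).
      assert (h1 : Rabs s <= 1) by apply Rabs_le, SIN_bound.
      assert (h2 : Rabs s <= t / 2).
      { apply Rle_trans with (1 := Rabs_sin_le _); rewrite Rabs_right; lra. }
      assert (h3 : s * s = Rabs s * Rabs s) by (unfold Rabs; destruct (Rcase_abs s); ring).
      assert (h4 := Rabs_pos s).
      rewrite Rabs_Ropp, Rabs_right.
      * apply Rle_div_l; [exact ht0|]; nra.
      * apply Rle_ge, Rdiv_le_0_compat; nra.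
  - apply filterlim_p_infty_inv with (Rabs (a - 1) / m ^ 2 + / a + 1); intros x hx.
    specialize (hax x hx).
    rewrite Rminus_0_r.
    replace (cos_integral (a * x) - cos_integral x)
      with (((cos_integral (a * x) - sin (a * x) / (a * x))
             - (cos_integral x - sin x / x))
            + (sin (a * x) / (a * x) - sin x / x)) by ring.
    assert (h1 : Rabs ((cos_integral (a * x) - sin (a * x) / (a * x))
             - (cos_integral x - sin x / x)) <= / (m * x) ^ 2 * Rabs (a * x - x)).
    { apply (increment_le (fun t => cos_integral t - sin t / t) (fun t => sin t / t ^ 2)).
      intros t [ht _]; apply (hmin x t hx) in ht.
      assert (hmx : 0 < m * x) by nra.
      split.
      - evar_last.
        + apply (is_derive_minus (V := R_NormedModule));
            [apply is_derive_cos_integral; lra|].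
          apply is_derive_div; [apply is_derive_sin|apply is_derive_id|lra].
        + unfold minus, plus, opp, one; simpl; field; lra.
      - assert (hm2 : 0 < (m * x) ^ 2) by (apply pow_lt; lra).
        assert (hmt : (m * x) ^ 2 <= t ^ 2) by (apply pow_incr; lra).
        unfold Rdiv; rewrite Rabs_mult, Rabs_inv, (Rabs_right (t ^ 2)) by lra.
        rewrite <- (Rmult_1_l (/ (m * x) ^ 2)).
        apply Rmult_le_compat; [apply Rabs_pos| |apply Rabs_le, SIN_bound|].
        + left; apply Rinv_0_lt_compat; lra.
        + now apply Rinv_le_contravar. }
    rewrite habs in h1 by exact hx.
    assert (hs : forall y, 0 < y -> Rabs (sin y / y) <= / y).
    { intros y hy; unfold Rdiv; rewrite Rabs_mult, Rabs_inv, (Rabs_right y) by lra.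
      rewrite <- (Rmult_1_l (/ y)) at 2; apply Rmult_le_compat_r.
      - left; now apply Rinv_0_lt_compat.
      - apply Rabs_le, SIN_bound. }
    apply Rle_trans with (1 := Rabs_triang _ _).
    apply Rle_trans with (Rabs (a - 1) / m ^ 2 / x + (/ (a * x) + / x)).
    + apply Rplus_le_compat.
      * apply Rle_trans with (1 := h1); right; field; lra.
      * apply Rle_trans with (1 := Rabs_triang _ _); rewrite Rabs_Ropp.
        apply Rplus_le_compat; apply hs; assumption.
    + right; field; lra.
Qed.

(** The factor [a^(p+1)] makes the formula valid at [a = 0], where it absorbs the
    divergence of the Frullani integral. *)
Lemma is_RInt_0_infty_pow_frullani_cos a p :
  is_RInt_0_infty (fun x => a ^ S p * ((cos (a * x) - cos x) / x))
    (- (a ^ S p * ln (Rabs a))).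
Proof.
  replace (- (a ^ S p * ln (Rabs a))) with (a ^ S p * - ln (Rabs a)) by ring.
  destruct (Req_dec a 0) as [h|h].
  - replace (a ^ S p * - ln (Rabs a)) with (0 * - ln 1)
      by (rewrite h, (pow_i (S p)) by lia; ring).
    generalize (is_RInt_0_infty_scal 0 _ _ (is_RInt_0_infty_frullani_cos 1 Rlt_0_1)).
    apply is_RInt_0_infty_ext; intros x _.
    rewrite h, (pow_i (S p)) by lia; ring.
  - apply is_RInt_0_infty_scal.
    generalize (is_RInt_0_infty_frullani_cos _ (Rabs_pos_lt a h)).
    apply is_RInt_0_infty_ext; intros x _.
    unfold Rabs; destruct (Rcase_abs a); [|reflexivity].
    now rewrite Ropp_mult_distr_l_reverse, cos_neg.
Qed.

(** * Integrals of powers of the sine over powers of the variable *)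

(** Each integration by parts trades one derivative for one power of [x]; the
    factors [1/i] that it produces build up the factorial. *)
Lemma is_RInt_0_infty_dsin_pow_descent n p l :
  (p < n)%nat -> is_RInt_0_infty (fun x => dsin_pow n p x / x) l ->
  is_sin_pow_integral n (S p) (l / INR (fact p)).
Proof.
  intros hp H.
  assert (hi : forall i, (i <= p)%nat ->
    is_RInt_0_infty (fun x => dsin_pow n (p - i) x / x ^ S i) (l / INR (fact i))).
  { induction i as [|i IH]; intros hip.
    - simpl fact; simpl INR; rewrite Rdiv_1_r, Nat.sub_0_r.
      revert H; apply is_RInt_0_infty_ext; intros x _; now rewrite pow_1.
    - specialize (IH ltac:(lia)).
      destruct (dsin_pow_bound n (p - S i)) as (M & hM & hb); [lia|].
      assert (hs : INR (S i) <> 0) by (apply not_0_INR; lia).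
      assert (hf : INR (fact i) <> 0) by apply INR_fact_neq_0.
      replace (l / INR (fact (S i))) with (/ INR (S i) * (l / INR (fact i)))
        by (rewrite fact_simpl, mult_INR; field; auto).
      apply is_RInt_0_infty_ext
        with (fun x => / INR (S i) * (INR (S i) * (dsin_pow n (p - S i) x / x ^ S (S i)))).
      { intros x hx; rewrite <- Rmult_assoc, Rinv_l by exact hs; apply Rmult_1_l. }
      apply is_RInt_0_infty_scal.
      apply (is_RInt_0_infty_by_parts (dsin_pow n (p - S i)) (dsin_pow n (p - i)) (S i) M);
        [lia| | | |exact IH].
      + intros x _; replace (p - i)%nat with (S (p - S i)) by lia.
        apply is_derive_dsin_pow.
      + intros x _; apply ex_derive_continuous_R.
        eexists; apply is_derive_dsin_pow.
      + intros x _; apply Rle_trans with (1 := hb x), Rmult_le_compat_l; [exact hM|].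
        apply pow_le_1_antitone; [|lia].
        split; [apply Rmin_glb; [lra|apply Rabs_pos]|apply Rmin_l]. }
  generalize (hi p (le_n p)); rewrite Nat.sub_diag.
  apply is_RInt_0_infty_ext; intros x _; now rewrite dsin_pow_0.
Qed.

Lemma cos_minus_INR_PI t m : cos (t - INR m * PI) = (-1) ^ m * cos t.
Proof.
  induction m as [|m IH].
  - simpl; rewrite Rmult_0_l, Rminus_0_r; ring.
  - rewrite S_INR; replace (t - (INR m + 1) * PI) with (t - INR m * PI - PI) by ring.
    rewrite cos_minus, cos_PI, sin_PI, IH; simpl; ring.
Qed.

Lemma pow_m1_sqr m : (-1) ^ m * (-1) ^ m = 1.
Proof. rewrite <- Rpow_mult_distr; replace (-1 * -1) with 1 by ring; apply pow1. Qed.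

Lemma pow_m1_minus n k : (k <= n)%nat -> (-1) ^ (n - k) = (-1) ^ n * (-1) ^ k.
Proof.
  intros h; replace n with (n - k + k)%nat at 2 by lia.
  rewrite pow_add, Rmult_assoc, pow_m1_sqr; ring.
Qed.

Lemma powerRZ_m1_opp m : powerRZ (-1) (- Z.of_nat m) = (-1) ^ m.
Proof.
  rewrite powerRZ_neg', <- pow_powerRZ.
  apply Rmult_eq_reg_l with ((-1) ^ m); [|apply pow_nonzero; lra].
  rewrite Rinv_r by (apply pow_nonzero; lra); now rewrite pow_m1_sqr.
Qed.

Lemma sin_pow_coef_reflect n p k :
  (k <= n)%nat -> sin_pow_coef n p (n - k) = (-1) ^ (n + p) * sin_pow_coef n p k.
Proof.
  intros hk; unfold sin_pow_coef.
  rewrite <- pascal_step1, pow_m1_minus, minus_INR, pow_add by exact hk.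
  replace (INR n - 2 * (INR n - INR k)) with (-1 * (INR n - 2 * INR k)) by ring.
  rewrite Rpow_mult_distr; ring.
Qed.

Lemma frequency_pos n k :
  (1 <= n)%nat -> (k <= (n - 1) / 2)%nat -> 0 < INR n - 2 * INR k.
Proof.
  intros hn hk.
  assert (h := Nat.Div0.mul_div_le (n - 1) 2).
  assert (h2 : (2 * k < n)%nat) by lia.
  apply lt_INR in h2; rewrite mult_INR in h2; simpl in h2; lra.
Qed.

Lemma sin_pow_integral_even n p m :
  n = (S p + 2 * m)%nat ->
  is_sin_pow_integral n (S p)
    ((-1) ^ m * PI / (2 ^ n * INR (fact p))
     * sum_f_R0 (sin_pow_coef n p) ((n - 1) / 2)).
Proof.
  intros hn.
  set (a := fun k => INR n - 2 * INR k).
  set (c := fun k => (-1) ^ m / 2 ^ n * sin_pow_coef n p k).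
  set (h := fun k => c k * (sign (a k) * (PI / 2))).
  assert (H2 : (2:R) ^ n <> 0) by (apply pow_nonzero; lra).
  assert (hf : INR (fact p) <> 0) by apply INR_fact_neq_0.
  assert (hI : is_RInt_0_infty (fun x => dsin_pow n p x / x) (sum_f_R0 h n)).
  { apply is_RInt_0_infty_ext with (fun x => sum_f_R0 (fun k => c k * (sin (a k * x) / x)) n).
    - intros x _; unfold Rdiv at 2, dsin_pow; rewrite (Rmult_comm _ (/ x)), scal_sum.
      apply sum_eq; intros k _; fold (a k).
      replace (a k * x - (INR n - INR p) * (PI / 2))
        with (a k * x - PI / 2 - INR m * PI)
        by (rewrite hn, plus_INR, mult_INR, S_INR; simpl; field).
      rewrite cos_minus_INR_PI, <- (cos_neg (a k * x - PI / 2)), Ropp_minus_distr, cos_shift.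
      unfold c, Rdiv; ring.
    - apply is_RInt_0_infty_sum; intros k _.
      apply is_RInt_0_infty_scal, is_RInt_0_infty_sin_div. }
  evar_last; [apply (is_RInt_0_infty_dsin_pow_descent n p _ ltac:(lia) hI)|].
  rewrite sum_fold_symmetric.
  - rewrite (sum_eq h (fun k => sin_pow_coef n p k * ((-1) ^ m * PI / 2 ^ n / 2))).
    + rewrite <- scal_sum; field; auto.
    + intros k hk; unfold h, c.
      rewrite sign_eq_1 by (apply frequency_pos; [lia|exact hk]); field; exact H2.
  - intros k hk; unfold h, c.
    replace (a (n - k)%nat) with (- a k) by (unfold a; rewrite minus_INR by exact hk; ring).
    rewrite sign_opp, sin_pow_coef_reflect by exact hk.
    replace (n + p)%nat with (S (2 * (p + m))) by lia.
    rewrite pow_1_odd; ring.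
  - intros k hk; unfold h.
    replace (a k) with 0; [rewrite sign_0; ring|].
    unfold a; rewrite <- hk, mult_INR; simpl; ring.
Qed.

(** For [n - j] even this is the vanishing of an alternating binomial sum of
    [(n-2k)^j]; the order of the zero gives it with no combinatorics. *)
Lemma dsin_pow_at_0 n j : (j < n)%nat -> dsin_pow n j 0 = 0.
Proof.
  intros hj; destruct (dsin_pow_bound n j) as (M & _ & h); [lia|].
  specialize (h 0); rewrite Rabs_R0, Rmin_right, pow_i, Rmult_0_r in h by (lra || lia).
  destruct (Req_dec (dsin_pow n j 0) 0) as [e|e]; [exact e|].
  apply Rabs_pos_lt in e; lra.
Qed.

(** The coefficients sum to [0], so subtracting [cos x] from every cosine changes
    nothing and makes each term integrable. *)
Lemma sin_pow_integral_odd n p m :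
  (1 <= p)%nat -> (n + 1 = S p + 2 * m)%nat -> (p < n)%nat ->
  is_sin_pow_integral n (S p)
    (- (-1) ^ m / (2 ^ (n - 1) * INR (fact p))
     * sum_f_R0 (fun k => sin_pow_coef n p k * ln (INR n - 2 * INR k)) ((n - 1) / 2)).
Proof.
  intros hp hn hpn.
  set (a := fun k => INR n - 2 * INR k).
  set (c := fun k => (-1) ^ m / 2 ^ n * sin_pow_coef n p k).
  set (h := fun k => - (c k * ln (Rabs (a k)))).
  assert (H2 : (2:R) ^ n <> 0) by (apply pow_nonzero; lra).
  assert (hf : INR (fact p) <> 0) by apply INR_fact_neq_0.
  assert (hcos : forall x, dsin_pow n p x = sum_f_R0 (fun k => c k * cos (a k * x)) n).
  { intros x; apply sum_eq; intros k _; fold (a k).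
    replace (a k * x - (INR n - INR p) * (PI / 2)) with (a k * x - INR m * PI).
    2:{ assert (hn' : INR n + 1 = INR p + 1 + 2 * INR m).
        { rewrite <- S_INR, <- (S_INR p), <- Nat.add_1_r, hn, plus_INR, mult_INR.
          reflexivity. }
        replace (INR n) with (INR p + 2 * INR m) by lra; field. }
    rewrite cos_minus_INR_PI; unfold c, Rdiv; ring. }
  assert (hc : sum_f_R0 c n = 0).
  { rewrite <- (dsin_pow_at_0 n p hpn), hcos; apply sum_eq; intros k _.
    rewrite Rmult_0_r, cos_0; ring. }
  assert (hI : is_RInt_0_infty (fun x => dsin_pow n p x / x) (sum_f_R0 h n)).
  { apply is_RInt_0_infty_ext
      with (fun x => sum_f_R0 (fun k => c k * ((cos (a k * x) - cos x) / x)) n).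
    - intros x _; rewrite hcos.
      transitivity (/ x * sum_f_R0 (fun k => c k * cos (a k * x)) n
                    - cos x / x * sum_f_R0 c n); [|rewrite hc; unfold Rdiv; ring].
      rewrite !scal_sum, <- minus_sum; apply sum_eq; intros k _; unfold Rdiv; ring.
    - apply is_RInt_0_infty_sum; intros k _.
      destruct p as [|p']; [lia|].
      set (b := (-1) ^ m / 2 ^ n * ((-1) ^ k * Binomial.C n k)).
      replace (h k) with (b * - (a k ^ S p' * ln (Rabs (a k))))
        by (unfold h, c, b, sin_pow_coef, a, Rdiv; ring).
      generalize (is_RInt_0_infty_scal b _ _ (is_RInt_0_infty_pow_frullani_cos (a k) p')).
      apply is_RInt_0_infty_ext; intros x _.
      unfold c, b, sin_pow_coef, a, Rdiv; ring. }
  evar_last; [apply (is_RInt_0_infty_dsin_pow_descent n p _ hpn hI)|].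
  rewrite sum_fold_symmetric.
  - rewrite (sum_eq h (fun k => (sin_pow_coef n p k * ln (a k)) * (- (-1) ^ m / 2 ^ n))).
    + rewrite <- scal_sum.
      replace (2 ^ n) with (2 * 2 ^ (n - 1)) by (rewrite tech_pow_Rmult; f_equal; lia).
      unfold a; field; split; [exact hf|apply pow_nonzero; lra].
    + intros k hk; unfold h, c.
      assert (ha : 0 < a k) by (apply frequency_pos; [lia|exact hk]).
      rewrite Rabs_right by lra; field; exact H2.
  - intros k hk; unfold h, c.
    replace (a (n - k)%nat) with (- a k) by (unfold a; rewrite minus_INR by exact hk; ring).
    rewrite Rabs_Ropp, sin_pow_coef_reflect by exact hk.
    replace (n + p)%nat with (2 * (p + m))%nat by lia.
    rewrite pow_1_even; ring.
  - intros k hk; unfold h, c, sin_pow_coef.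
    replace (INR n - 2 * INR k) with 0 by (rewrite <- hk, mult_INR; simpl; ring).
    rewrite (pow_i p) by lia; unfold Rdiv; ring.
Qed.

Theorem theorem1 (n q : nat) (hq : (1 <= q)%nat) (hqn : (q <= n)%nat) :
  (Nat.Even (n + q) ->
   is_sin_pow_integral n q
     (powerRZ (-1) ((Z.of_nat q - Z.of_nat n) / 2) * PI
        / (2 ^ n * INR (fact (q - 1)))
      * sum_f_R0
          (fun k : nat =>
             (-1) ^ k * Binomial.C n k * (INR n - 2 * INR k) ^ (q - 1))
          ((n - 1) / 2)))
  /\
  (Nat.Odd (n + q) -> (2 <= q)%nat ->
   is_sin_pow_integral n q
     (powerRZ (-1) ((Z.of_nat q - Z.of_nat n + 1) / 2)
        / (2 ^ (n - 1) * INR (fact (q - 1)))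
      * sum_f_R0
          (fun k : nat =>
             (-1) ^ k * Binomial.C n k * (INR n - 2 * INR k) ^ (q - 1)
               * ln (INR n - 2 * INR k))
          ((n - 1) / 2))).
Proof.
  destruct q as [|p]; [lia|].
  replace (S p - 1)%nat with p by lia.
  split.
  - intros [r hr].
    assert (hm : n = (S p + 2 * (r - S p))%nat) by lia.
    set (m := (r - S p)%nat) in *.
    replace ((Z.of_nat (S p) - Z.of_nat n) / 2)%Z with (- Z.of_nat m)%Z
      by (clearbody m; Z.div_mod_to_equations; lia).
    rewrite powerRZ_m1_opp; exact (sin_pow_integral_even n p m hm).
  - intros [r hr] hq2.
    assert (hm : (n + 1 = S p + 2 * (r - p))%nat) by lia.
    set (m := (r - p)%nat) in *.
    (* Here [n - q + 1 = 2 m], so the exponent is [1 - m]: the extra factor [-1] is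
       the sign of the Frullani integral. *)
    replace ((Z.of_nat (S p) - Z.of_nat n + 1) / 2)%Z with (1 + - Z.of_nat m)%Z
      by (clearbody m; Z.div_mod_to_equations; lia).
    rewrite powerRZ_add, powerRZ_1, powerRZ_m1_opp by lra.
    replace (-1 * (-1) ^ m) with (- (-1) ^ m) by ring.
    apply sin_pow_integral_odd; lia.
Qed.
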